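(* Let $T\in(0,\infty)$, $\theta\in\mathcal P_T$, let $(\Omega,\mathcal F,\mathbb P)$ be a probability space, and let $(E,\|\cdot\|_E)$ be a Banach space. Write $\mathcal L^p=\mathcal L^p(\mathbb P;\|\cdot\|_E)$. Then: (i) for all $p\in[1,\infty)$, $\beta\in[0,1]$, $\gamma\in[\beta,1]$ and all $(\mathcal F,\|\cdot\|_E)$-strongly measurable stochastic processes $X,Y\colon[0,T]\times\Omega\to E$ it holds that $$\|X-Y\|_{\mathcal C^\beta([0,T],\|\cdot\|_{\mathcal L^p})}\le\bigl(2|d_{\max}(\theta)|^{-\beta}+1\bigr)\Bigl[\sup_{t\in\theta}\|X_t-Y_t\|_{\mathcal L^p}+|d_{\max}(\theta)|^\gamma\bigl(|X|_{\mathcal C^\gamma([0,T],\|\cdot\|_{\mathcal L^p})}+|Y|_{\mathcal C^\gamma([0,T],\|\cdot\|_{\mathcal L^p})}\bigr)\Bigr];$$ (ii) for all $p\in(1,\infty)$, $\beta\in(\frac1p,1]$, $\alpha\in[0,\beta-\frac1p)$, $\gamma\in[\beta,1]$ and all $(\mathcal F,\|\cdot\|_E)$-strongly measurable stochastic processes $X,Y\colon[0,T]\times\Omega\to E$ with continuous sample paths it holds that $$\begin{aligned}&\Bigl(\mathbb E\bigl[\|X-Y\|^p_{\mathcal C^\alpha([0,T],\|\cdot\|_E)}\bigr]\Bigr)^{1/p}\le\Xi_{T,p,\alpha,\beta}\,\|X-Y\|_{\mathcal C^\beta([0,T],\|\cdot\|_{\mathcal L^p})}\\&\le\Xi_{T,p,\alpha,\beta}\bigl(2|d_{\max}(\theta)|^{-\beta}+1\bigr)\Bigl[\sup_{t\in\theta}\|X_t-Y_t\|_{\mathcal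 L^p}+|d_{\max}(\theta)|^\gamma\bigl(|X|_{\mathcal C^\gamma([0,T],\|\cdot\|_{\mathcal L^p})}+|Y|_{\mathcal C^\gamma([0,T],\|\cdot\|_{\mathcal L^p})}\bigr)\Bigr].\end{aligned}$$
   Context: $\mathcal P_T$ is the set of all finite sets $\theta\subseteq[0,T]$ with $\{0,T\}\subseteq\theta$. For $\theta=\{\theta_0<\theta_1<\dots<\theta_n\}\in\mathcal P_T$, $d_{\max}(\theta)=\max_{j\in\{1,\dots,n\}}|\theta_j-\theta_{j-1}|$. A stochastic process $X\colon[0,T]\times\Omega\to E$ is $(\mathcal F,\|\cdot\|_E)$-strongly measurable if each $X_t\colon\Omega\to E$ is strongly measurable. For a strongly measurable $Z\colon\Omega\to E$, $\|Z\|_{\mathcal L^p(\mathbb P;\|\cdot\|_E)}=(\mathbb E[\|Z\|_E^p])^{1/p}\in[0,\infty]$. For a vector space $V$ with a seminorm $\|\cdot\|$ which may take the value $\infty$, $r\in[0,1]$ and $f\colon[0,T]\to V$: $|f|_{\mathcal C^r([0,T],\|\cdot\|)}=\sup_{s\neq t}\|f(t)-f(s)\|/|t-s|^r\in[0,\infty]$ and $\|f\|_{\mathcal C^r([0,T],\|\cdot\|)}=\sup_t\|f(t)\|+|f|_{\mathcal C^r([0,T],\|\cdot\|)}$. For $\|\cdot\|=\|\cdot\|_{\mathcal L^p}$ a process is regarded as the function $t\mapsto X_t$ with values in strongly measurable functions; for $\|\cdot\|=\|\cdot\|_E$ the norm is applied to each sample path. $\Xi=(\Xi_{T,p,\alpha,\beta})_{T,p,\alpha,\beta\in\mathbb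 R}\colon\mathbb R^4\to\mathbb R$ is a fixed function with the following property (such a function exists by the Kolmogorov-Chentsov continuity theorem): for every $T\in[0,\infty)$, $p\in(1,\infty)$, $\beta\in(\frac1p,1]$, every Banach space $(E,\|\cdot\|_E)$, every probability space $(\Omega,\mathcal F,\mathbb P)$, and every strongly measurable process $X$ with $\|X\|_{\mathcal C^\beta([0,T],\|\cdot\|_{\mathcal L^p(\mathbb P;\|\cdot\|_E)})}<\infty$ there exists an $(\mathcal F,\|\cdot\|_E)$-strongly measurable process $Y\colon[0,T]\times\Omega\to E$ with continuous sample paths such that $\mathbb P(X_t=Y_t)=1$ for all $t\in[0,T]$ and such that for every $\alpha\in[0,\beta-\frac1p)$, $(\mathbb E[\|Y\|^p_{\mathcal C^\alpha([0,T],\|\cdot\|_E)}])^{1/p}\le\Xi_{T,p,\alpha,\beta}\|X\|_{\mathcal C^\beta([0,T],\|\cdot\|_{\mathcal L^p(\mathbb P;\|\cdot\|_E)})}<\infty$. *)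

(* Defs.v *)
From HB Require Import structures.
From mathcomp Require Export all_boot all_order all_algebra finmap.
From mathcomp Require Export all_classical all_reals all_analysis.
Export Order.TTheory GRing.Theory Num.Theory.
Export numFieldNormedType.Exports.

Set Implicit Arguments.
Unset Strict Implicit.
Unset Printing Implicit Defensive.

Local Open Scope classical_set_scope.
Local Open Scope ring_scope.

(* Supremum in [0, +oo]: the supremum of the empty set is 0, not -oo. This
   matters for the Hoelder seminorm on [0, T] when T = 0. *)
Definition nnsup (R : realType) (A : set (\bar R)) : \bar R :=
  ereal_sup (0%E |` A).

(* Processes and paths indexed by [0, T] are total functions on R of which only
   the values on [0, T] are used. The [0, +oo]-valued seminorm of V is the
   parameter N. *)
Definition holder_seminorm (R : realType) (V : lmodType R) (N : V -> \bar R)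
    (T r : R) (f : R -> V) : \bar R :=
  nnsup [set (N (f q.2 - f q.1)%R * ((`|q.2 - q.1| `^ r)^-1)%:E)%E |
         q in [set q : R * R |
               [/\ q.1 \in `[0, T], q.2 \in `[0, T] & q.1 != q.2]]].

Definition holder_norm (R : realType) (V : lmodType R) (N : V -> \bar R)
    (T r : R) (f : R -> V) : \bar R :=
  (nnsup [set N (f t) | t in `[0%R, T]] + holder_seminorm N T r f)%E.

Definition enorm (R : realType) (E : normedModType R) (x : E) : \bar R :=
  (`|x|)%:E.

(* For p : R, Lnorm P p%:E g is (\int[P]_w `|g w| `^ p) `^ p^-1. *)
Definition LpE (R : realType) (d : measure_display) (Omega : measurableType d)
    (P : probability Omega R) (E : normedModType R) (p : R)
    (Z : Omega -> E) : \bar R :=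
  Lnorm P p%:E (fun w => enorm (Z w)).

Definition simple_function (R : realType) (d : measure_display)
    (Omega : measurableType d) (E : normedModType R) (Z : Omega -> E) : Prop :=
  finite_set (range Z) /\ forall x : E, measurable (Z @^-1` [set x]).

Definition strongly_measurable (R : realType) (d : measure_display)
    (Omega : measurableType d) (E : normedModType R) (Z : Omega -> E) : Prop :=
  exists2 u : nat -> Omega -> E,
    (forall n, simple_function (u n)) &
    forall w, (fun n => u n w) @ \oo --> Z w.

Definition strongly_measurable_process (R : realType) (d : measure_display)
    (Omega : measurableType d) (E : normedModType R) (T : R)
    (X : R -> Omega -> E) : Prop :=
  forall t, t \in `[0, T] -> strongly_measurable (X t).

Definition continuous_paths (R : realType) (d : measure_display)
    (Omega : measurableType d) (E : normedModType R) (T : R)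
    (X : R -> Omega -> E) : Prop :=
  forall w, {within `[0, T], continuous (fun t => X t w)}.

Definition process_holder_norm (R : realType) (d : measure_display)
    (Omega : measurableType d) (P : probability Omega R)
    (E : normedModType R) (p T r : R) (X : R -> Omega -> E) : \bar R :=
  holder_norm (LpE P p : (Omega -> E) -> \bar R) T r X.

Definition process_holder_seminorm (R : realType) (d : measure_display)
    (Omega : measurableType d) (P : probability Omega R)
    (E : normedModType R) (p T r : R) (X : R -> Omega -> E) : \bar R :=
  holder_seminorm (LpE P p : (Omega -> E) -> \bar R) T r X.

Definition path_holder_norm (R : realType) (d : measure_display)
    (Omega : measurableType d) (E : normedModType R) (T r : R)
    (X : R -> Omega -> E) (w : Omega) : \bar R :=
  holder_norm (@enorm R E) T r (fun t => X t w).

Definition is_partition (R : realType) (T : R) (theta : {fset R}) : Prop :=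
  [/\ forall t, t \in theta -> t \in `[0, T], 0 \in theta & T \in theta].

Definition dmax (R : realType) (theta : {fset R}) : R :=
  let s := sort <=%R (enum_fset theta) in
  \big[Num.max/0]_(1 <= j < size s) `|s`_j - s`_j.-1|.

(* Xi is an admissible constant in the Kolmogorov-Chentsov theorem; it depends
   neither on E nor on the probability space, and the modification Y does not
   depend on alpha. *)
Definition kolmogorov_chentsov_constant (R : realType)
    (Xi : R -> R -> R -> R -> R) : Prop :=
  forall T p beta : R, 0 <= T -> 1 < p -> p^-1 < beta -> beta <= 1 ->
  forall (E : completeNormedModType R) (d : measure_display)
    (Omega : measurableType d) (P : probability Omega R)
    (X : R -> Omega -> E),
  strongly_measurable_process T X ->
  (process_holder_norm P p T beta X < +oo)%E ->
  exists Y : R -> Omega -> E,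
    [/\ strongly_measurable_process T Y,
        continuous_paths T Y,
        forall t, t \in `[0, T] -> P [set w | X t w = Y t w] = 1%E &
        forall alpha : R, 0 <= alpha -> alpha < beta - p^-1 ->
          (Lnorm P p%:E (path_holder_norm T alpha Y)
             <= (Xi T p alpha beta)%:E * process_holder_norm P p T beta X)%E /\
          ((Xi T p alpha beta)%:E * process_holder_norm P p T beta X < +oo)%E].

(* Main.v *)
(* Idea: let Z = X - Y, let delta be the mesh of theta, let S be the supremum of
   the L^p-norms of Z over theta, and let K be the sum of the gamma-Hoelder
   seminorms of X and Y. Every t is within delta of a grid point, so
   |Z_t| <= M with M = S + delta^gamma K. For |t - s| >= delta the increment of
   Z is at most 2M <= 2M delta^-beta |t - s|^beta; for |t - s| < delta it is at
   most K |t - s|^gamma <= K delta^(gamma - beta) |t - s|^beta. This gives (i).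
   For (ii), the Kolmogorov-Chentsov modification of Z agrees with Z almost
   surely at all rational times, hence by continuity at all times. *)
Require Import Defs.
From mathcomp Require Import measurable_realfun ring lra.

Set Implicit Arguments.
Unset Strict Implicit.
Unset Printing Implicit Defensive.

Local Open Scope classical_set_scope.
Local Open Scope ring_scope.

(** * Monotonicity of integrals and Lp norms up to null sets *)

Import HBNNSimple.

(* No measurability is required, since the library integral of a nonnegative
   function is a supremum over the measurable simple functions below it; so the
   measurability of the pathwise Hoelder norm never has to be established. *)
Lemma ae_le_lower_integral (d : measure_display) (U : measurableType d)
    (R : realType) (mu : {measure set U -> \bar R}) (f g : U -> \bar R) :
  (forall x, 0 <= f x)%E -> (forall x, 0 <= g x)%E ->
  {ae mu, forall x, (f x <= g x)%E} ->
  (\int[mu]_x f x <= \int[mu]_x g x)%E.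
Proof.
move=> f0 g0 [A [mA muA fgA]].
rewrite !ge0_integralTE//; apply: ge_ereal_sup => _ [h hf <-].
have mAC : measurable (~` A) by exact: measurableC.
(* The witness is [h] set to zero on the null set [A]: it lies below [g] everywhere and has the same
   integral as [h]. *)
apply: ereal_sup_ubound; exists (proj_nnsfun h mAC).
  move=> x; rewrite -mrestrict patchE; case: ifPn => [|_]; last exact: g0.
  rewrite inE => xA; rewrite (le_trans (hf x))//; apply: contrapT => fg.
  by apply: xA; exact: fgA.
transitivity (\int[mu]_(x in ~` A) (h x)%:E)%E.
  by rewrite integral_nnsfun// (mrestrict _ mAC).
transitivity (\int[mu]_x (h x)%:E)%E; last first.
  by rewrite integral_nnsfun// patch_setT.
rewrite [RHS](ge0_negligible_integral mA) ?setTD//; first exact/measurable_EFinP.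
by move=> x _; rewrite lee_fin.
Qed.

Lemma ae_le_Lnorm (d : measure_display) (U : measurableType d)
    (R : realType) (mu : {measure set U -> \bar R}) (p : R)
    (f g : U -> \bar R) : 0 <= p ->
  {ae mu, forall x, (`|f x| <= `|g x|)%E} ->
  (Lnorm mu p%:E f <= Lnorm mu p%:E g)%E.
Proof.
move=> p0 fg; rewrite unlock.
have ip (h : U -> \bar R) : (0 <= \int[mu]_x (`|h x| `^ p))%E.
  by apply: integral_ge0 => x _; exact: poweR_ge0.
apply: gt0_ler_poweR; rewrite ?invr_ge0// ?in_itv/= ?leey ?andbT//.
apply: ae_le_lower_integral => [x|x|]; rewrite ?poweR_ge0//.
apply: filterS fg => x fgx.
by apply: gt0_ler_poweR => //; rewrite in_itv/= abse_ge0 leey.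
Qed.

(** * Strong measurability and the Lp triangle inequality *)

Section strong_measurability.
Context {R : realType} {d : measure_display} {Omega : measurableType d}.

Lemma simple_functionB (E : normedModType R) (u v : Omega -> E) :
  simple_function u -> simple_function v ->
  simple_function (fun w => u w - v w).
Proof.
move=> [fu mu] [fv mv]; split.
  apply: (@sub_finite_set _ _ [set x - y | x in range u & y in range v]).
    by move=> _ [w _ <-]; exists (u w); [exists w|exists (v w) => //; exists w].
  exact: finite_image2.
move=> x.
(* Split along the finitely many values [a] of [u]: where [u] equals [a], the difference is [x]
   exactly when [v] equals [a - x]. *)
rewrite (_ : _ @^-1` _ =
  \bigcup_(a in range u) (u @^-1` [set a] `&` v @^-1` [set a - x])).
  by apply: fin_bigcup_measurable => // a _; exact: measurableI.
apply/seteqP; split=> [w <-|w [_ _ [/= <- ->]]].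
  by exists (u w); [exists w|split => //=; rewrite subKr].
by rewrite subKr.
Qed.

Lemma strongly_measurableB (E : normedModType R) (Z W : Omega -> E) :
  strongly_measurable Z -> strongly_measurable W ->
  strongly_measurable (fun w => Z w - W w).
Proof.
move=> [u su uZ] [v sv vW]; exists (fun n w => u n w - v n w).
  by move=> n; exact: simple_functionB.
by move=> w; apply: cvgB; [exact: uZ|exact: vW].
Qed.

Lemma strongly_measurable_cst (E : normedModType R) (x : E) :
  strongly_measurable (fun _ : Omega => x).
Proof.
exists (fun _ _ => x) => [_|w]; last exact: cvg_cst.
split; first by apply: (@sub_finite_set _ _ [set x]) => // _ [w _ <-].
by move=> y; rewrite preimage_cst; case: ifP.
Qed.

Lemma measurable_norm_simple (E : normedModType R) (u : Omega -> E) :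
  simple_function u -> measurable_fun setT (fun w => `|u w|).
Proof.
move=> [fu mu] _ B mB; rewrite setTI.
rewrite (_ : _ @^-1` _ =
  \bigcup_(a in range u `&` [set a | B `|a|]) u @^-1` [set a]).
  by apply: fin_bigcup_measurable => //; exact: finite_setIl.
apply/seteqP; split=> [w Bw|w [a [_ Ba] /= ->//]].
by exists (u w) => //; split => //; exists w.
Qed.

Lemma strongly_measurable_norm (E : normedModType R) (Z : Omega -> E) :
  strongly_measurable Z -> measurable_fun setT (fun w => `|Z w|).
Proof.
move=> [u su uZ].
apply: (@measurable_fun_cvg _ _ _ _ (fun n w => `|u n w|)) => [n|w _].
  exact: measurable_norm_simple.
by apply: cvg_norm; exact: uZ.
Qed.

Variable P : probability Omega R.

Lemma LpE_ge0 (E : normedModType R) (p : R) (Z : Omega -> E) :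
  (0 <= LpE P p Z)%E.
Proof. exact: Lnorm_ge0. Qed.

(** Minkowski's inequality for the real functions [|Z|] and [|W|]. The pointwise bound on [U] lets
    one lemma serve both sums and differences. *)
Lemma LpE_le_add (E : normedModType R) (p : R) (U Z W : Omega -> E) :
  1 <= p -> strongly_measurable Z -> strongly_measurable W ->
  (forall w, `|U w| <= `|Z w| + `|W w|) ->
  (LpE P p U <= LpE P p Z + LpE P p W)%E.
Proof.
move=> p1 mZ mW UZW.
apply: (@le_trans _ _ (Lnorm P p%:E
  (EFin \o ((fun w => `|Z w|) \+ (fun w => `|W w|))%R))).
  apply: ae_le_Lnorm; first exact: le_trans p1.
  apply: aeW => w /=; rewrite lee_fin normr_id ger0_norm ?UZW//.
by apply: minkowski_EFin => //; exact: strongly_measurable_norm.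
Qed.

(** The event of equality is the zero set of the measurable function [|Z - W|], so its complement is
    a measurable null set. *)
Lemma ae_eq_strongly_measurable (E : normedModType R) (Z W : Omega -> E) :
  strongly_measurable Z -> strongly_measurable W ->
  P [set w | Z w = W w] = 1%E -> {ae P, forall w, Z w = W w}.
Proof.
move=> mZ mW PZW.
have mA : measurable [set w | Z w = W w].
  have := strongly_measurable_norm (strongly_measurableB mZ mW).
  move=> /(_ measurableT [set 0] (measurable_set1 0)); rewrite setTI.
  congr measurable; apply/seteqP; split=> w /=.
    by move=> /eqP; rewrite normr_eq0 subr_eq0 => /eqP.
  by move=> ->; rewrite subrr normr0.
exists (~` [set w | Z w = W w]); split => //; first exact: measurableC.
by rewrite probability_setC// PZW subee.
Qed.

End strong_measurability.

(** * Grid points near a given time *)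

Section partitions.
Context {R : realType}.
Implicit Types (T t : R) (theta : {fset R}).

Lemma partition_gap T theta t : is_partition T theta -> 0 <= t -> t < T ->
  exists a b : R, [/\ a \in theta, b \in theta, a <= t, t < b &
    b - a <= dmax theta].
Proof.
move=> [_ h0 hT] t0 tT; rewrite /dmax.
(* [i] is the first index whose grid point exceeds [t]; the gap sought runs from [i.-1] to [i]. *)
set s := sort <=%R _; pose i := find (> t) s.
have ss : sorted <=%R s by exact: sort_le_sorted.
have mems x : (x \in s) = (x \in theta) by rewrite mem_sort.
have hs : has (> t) s by apply/hasP; exists T; rewrite ?mems.
have ltis : (i < size s)%N by rewrite -has_find.
have ti : t < s`_i by exact: (nth_find 0 hs).
(* The grid contains 0, so its least point is at most 0 and hence at most [t]. *)
have i0 : (0 < i)%N.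
  rewrite lt0n; apply/eqP => i0; move: ti; rewrite i0 ltNge => /negP; apply.
  apply: le_trans t0; have := h0; rewrite -mems => /(nthP 0)[j js js0].
  rewrite -[leRHS]js0.
  by apply: (sorted_leq_nth le_trans le_refl 0 ss 0%N j) => //;
    rewrite inE (leq_ltn_trans _ js).
have ltis1 : (i.-1 < size s)%N by exact: leq_ltn_trans (leq_pred _) ltis.
exists s`_i.-1; exists s`_i; split; rewrite -?mems ?mem_nth//.
  by rewrite leNgt (before_find 0)// ltn_predL.
rewrite (le_trans (ler_norm _))//.
rewrite (bigD1_seq i) ?iota_uniq ?mem_index_iota ?i0//=.
by rewrite le_max lexx.
Qed.

(** The gap that contains time 0 has positive length. *)
Lemma dmax_gt0 T theta : 0 < T -> is_partition T theta -> 0 < dmax theta.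
Proof.
move=> T0 /partition_gap => /(_ 0 (lexx _) T0)[a [b [_ _ a0 b0]]].
by apply: lt_le_trans; rewrite subr_gt0 (le_lt_trans a0).
Qed.

Lemma partition_dist T theta t : 0 < T -> is_partition T theta ->
  t \in `[0, T] -> exists2 s, s \in theta & `|t - s| <= dmax theta.
Proof.
move=> T0 hth; rewrite in_itv/= => /andP[t0]; rewrite le_eqVlt => /predU1P[->|tT].
  (* No gap extends beyond [T], so the final time serves as its own grid point. *)
  by exists T; [case: hth|rewrite subrr normr0 ltW// (dmax_gt0 T0)].
have [a [b [ath _ ta tb ba]]] := partition_gap hth t0 tT.
by exists a => //; rewrite ger0_norm ?subr_ge0// (le_trans _ ba)// lerB// ltW.
Qed.

End partitions.

(** * Suprema in [0, +oo] *)

Section nonnegative_supremum.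
Context {R : realType}.
Implicit Types (A : set (\bar R)).
Local Open Scope ereal_scope.

Lemma nnsup_ge0 A : 0 <= nnsup A.
Proof. by apply: ereal_sup_ubound; left. Qed.

Lemma le_nnsup A x : A x -> x <= nnsup A.
Proof. by move=> Ax; apply: ereal_sup_ubound; right. Qed.

Lemma nnsup_le A x : 0 <= x -> (forall y, A y -> y <= x) -> nnsup A <= x.
Proof. by move=> x0 Ax; apply: ge_ereal_sup => y [->|/Ax]. Qed.

End nonnegative_supremum.

(** * Hoelder norms and the deterministic grid estimate *)

Section holder.
Context {R : realType} {V : lmodType R} (N : V -> \bar R) (T : R).
Implicit Types (r s t : R) (f : R -> V).

Lemma holder_seminorm_ge0 r f : (0 <= holder_seminorm N T r f)%E.
Proof. exact: nnsup_ge0. Qed.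

Lemma holder_norm_ge0 r f : (0 <= holder_norm N T r f)%E.
Proof. by rewrite adde_ge0// nnsup_ge0. Qed.

Lemma le_holder_seminorm r f s t : s \in `[0, T] -> t \in `[0, T] -> s != t ->
  (N (f t - f s) <= holder_seminorm N T r f * (`|t - s| `^ r)%:E)%E.
Proof.
move=> hs ht st.
have ts0 : 0 < `|t - s| `^ r by rewrite powR_gt0// normr_gt0 subr_eq0 eq_sym.
by rewrite -lee_pdivrMr//; apply: le_nnsup; exists (s, t).
Qed.

(** The triangle inequalities are assumed only along [f]: in the application [V] consists of all
    functions from [Omega] to [E], while Minkowski's inequality is available for strongly measurable
    ones. *)
Lemma holder_norm_le_grid (theta : set R) (delta beta gamma : R) f (K : \bar R) :
  (forall v, 0 <= N v)%E ->
  0 < delta -> 0 <= beta -> beta <= gamma -> theta `<=` `[0, T]%classic ->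
  (forall t, t \in `[0, T] -> exists2 s, theta s & `|t - s| <= delta) ->
  (forall s t, s \in `[0, T] -> t \in `[0, T] ->
    (N (f t) <= N (f s) + N (f t - f s))%E) ->
  (forall s t, s \in `[0, T] -> t \in `[0, T] ->
    (N (f t - f s) <= N (f t) + N (f s))%E) ->
  (0 <= K)%E ->
  (forall s t, s \in `[0, T] -> t \in `[0, T] -> s != t ->
    (N (f t - f s) <= K * (`|t - s| `^ gamma)%:E)%E) ->
  (holder_norm N T beta f <= (2 * delta `^ (- beta) + 1)%:E *
     (nnsup [set N (f t) | t in theta] + (delta `^ gamma)%:E * K))%E.
Proof.
move=> N0 d0 b0 bg thT dense hD hS K0 hK.
have g0 := le_trans b0 bg.
set S := nnsup _.
have S0 : (0 <= S)%E by exact: nnsup_ge0.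
have dg0 : 0 < delta `^ gamma by rewrite powR_gt0.
have c0 : 0 < 2 * delta `^ (- beta) + 1.
  by rewrite ltr_wpDl// mulr_ge0// powR_ge0.
have [SKoo|] := eqVneq (S + (delta `^ gamma)%:E * K)%E +oo%E.
  by rewrite SKoo gt0_muley ?lte_fin// leey.
have [->|KNoo] := eqVneq K +oo%E.
  by rewrite gt0_muley ?lte_fin// addey ?eqxx// gt_eqF// (lt_le_trans _ S0).
have [->|SNoo _] := eqVneq S +oo%E.
  by rewrite addye ?eqxx// gt_eqF// (lt_le_trans (ltNyr 0))// mule_ge0// lee_fin ltW.
have /fineK : K \is a fin_num by rewrite ge0_fin_numE// ltey.
have /fineK : S \is a fin_num by rewrite ge0_fin_numE// ltey.
move: (fine S) (fine K) => s k sS kK.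
rewrite -kK lee_fin in K0; rewrite -sS lee_fin in S0.
rewrite -sS -kK -EFinM.
set M := s + _.
have M0 : 0 <= M by rewrite addr_ge0// mulr_ge0// ltW.
have hM t : t \in `[0, T] -> (N (f t) <= M%:E)%E.
  move=> tT; have [u uth tu] := dense _ tT; have uT := thT _ uth.
  have us : (N (f u) <= s%:E)%E by rewrite sS; apply: le_nnsup; exists u.
  (* [hK] speaks of distinct times, so the case where [t] is the chosen grid point is separate. *)
  have [->|ut] := eqVneq t u.
    by rewrite (le_trans us)// lee_fin lerDl mulr_ge0// ltW.
  rewrite (le_trans (hD u t _ _))// EFinD leeD//.
  rewrite (le_trans (hK _ _ _ _ _))// 1?eq_sym// -kK -EFinM lee_fin mulrC.
  by rewrite ler_wpM2r// ge0_ler_powR// nnegrE// ltW.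
(* The summand 1 of the factor pays for the supremum of the norms, the other summand for the
   seminorm. *)
rewrite /holder_norm mulrDl mul1r (addrC _ M) EFinD leeD//.
  by apply: nnsup_le => [|_ [t tT <-]]; [rewrite lee_fin|exact: hM].
apply: nnsup_le => [|_ [[u t] /= [uT tT ut] <-]].
  by rewrite lee_fin mulr_ge0 ?mulr_ge0 ?powR_ge0.
have tu0 : 0 < `|t - u| by rewrite normr_gt0 subr_eq0 eq_sym.
rewrite lee_pdivrMr ?powR_gt0// -EFinM.
have [dtu|tud] := leP delta `|t - u|.
  rewrite (le_trans (hS _ _ _ _))// (@le_trans _ _ (M + M)%:E)//.
    by rewrite EFinD leeD// hM.
  rewrite lee_fin -mulr2n -(mulr_natl M) powRN.
  (* The last quotient is at least 1, since the increment is long. *)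
  rewrite [leRHS](_ : _ = 2 * M * (`|t - u| `^ beta / delta `^ beta)); last by ring.
  by rewrite ler_peMr ?mulr_ge0// ler_pdivlMr ?powR_gt0// mul1r
    ge0_ler_powR// nnegrE// ltW.
rewrite (le_trans (hK _ _ _ _ _))// -kK -EFinM lee_fin.
rewrite -{1}(subrK beta gamma) powRD ?(gt_eqF tu0) ?implybT// mulrA ler_wpM2r ?powR_ge0//.
rewrite (@le_trans _ _ (delta `^ (- beta) * M))//; last first.
  by rewrite -mulrA ler_peMl ?ler1n// mulr_ge0// powR_ge0.
rewrite (@le_trans _ _ (delta `^ (- beta) * (delta `^ gamma * k)))//.
  rewrite mulrA -powRD ?(gt_eqF d0) ?implybT// (addrC _ gamma) mulrC ler_wpM2r//.
  by rewrite ge0_ler_powR ?subr_ge0// ?nnegrE ltW.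
by rewrite ler_wpM2l ?powR_ge0// lerDr.
Qed.

End holder.

(** * Equality of paths and indistinguishability of continuous modifications *)

Lemma eq_holder_norm (R : realType) (V : lmodType R) (N : V -> \bar R)
    (T r : R) (f g : R -> V) : (forall t, t \in `[0, T] -> f t = g t) ->
  holder_norm N T r f = holder_norm N T r g.
Proof.
move=> fg; congr (nnsup _ + nnsup _)%E; apply/eq_imagel.
  by move=> t tT; rewrite fg.
by move=> [s t] /= [sT tT _]; rewrite !fg.
Qed.

(** If [f - g] were nonzero at [t], it would be nonzero on a relative neighbourhood of [t], which
    contains a rational time. *)
Lemma eq_continuous_ratr (R : realType) (E : normedModType R) (T : R)
    (f g : R -> E) : 0 < T ->
  {within `[0, T], continuous f} -> {within `[0, T], continuous g} ->
  (forall q : rat, ratr q \in `[0, T] -> f (ratr q) = g (ratr q)) ->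
  forall t : R, t \in `[0, T] -> f t = g t.
Proof.
move=> T0 cf cg fg t tT; apply: contrapT => /eqP; rewrite -subr_eq0 => fgt.
have {cf cg} : (fun x => f x - g x) @ within `[0, T] (nbhs t) --> f t - g t.
  by apply: cvgB; [move/subspace_continuousP: cf|move/subspace_continuousP: cg];
    apply.
move=> /cvgr_neq0 /(_ fgt) /nbhs_ballP[e /= e0 he].
move: tT; rewrite in_itv/= => /andP[t0 tT].
(* Since [0 < T], this open interval is nonempty even when [t] is an endpoint. *)
have : Num.max 0 (t - e) < Num.min T (t + e).
  by rewrite lt_min !gt_max T0 ltr_wpDl//=; apply/andP; split; lra.
move=> /rat_in_itvoo[q]; rewrite in_itv/= gt_max lt_min => /andP[/andP[q0 qe] /andP[qT qe']].
have qI : ratr q \in `[0, T] by rewrite in_itv/= !ltW.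
have tq : ball t e (ratr q) by rewrite /ball/= ltr_norml; apply/andP; split; lra.
by have := he _ tq qI; rewrite /= fg// subrr eqxx.
Qed.

Lemma ae_eq_continuous_paths (R : realType) (d : measure_display)
    (Omega : measurableType d) (P : probability Omega R) (E : normedModType R)
    (T : R) (X Y : R -> Omega -> E) : 0 < T ->
  strongly_measurable_process T X -> strongly_measurable_process T Y ->
  continuous_paths T X -> continuous_paths T Y ->
  (forall t, t \in `[0, T] -> P [set w | X t w = Y t w] = 1%E) ->
  {ae P, forall w, forall t, t \in `[0, T] -> X t w = Y t w}.
Proof.
move=> T0 mX mY cX cY XY.
(* Rational times are indexed by their codes, so that countably many null sets can be combined;
   [Q n] holds vacuously if [n] codes no rational in [0, T]. *)
pose Q (n : nat) (w : Omega) := forall q : rat, choice.pickle q = n ->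
  ratr q \in `[0, T] -> X (ratr q) w = Y (ratr q) w.
have : {ae P, forall w, forall n, Q n w}.
  apply: ae_foralln => n.
  have [[q qn qT]|nq] := pselect (exists2 q : rat, choice.pickle q = n & (ratr q : R) \in `[0, T]).
    have := ae_eq_strongly_measurable (mX _ qT) (mY _ qT) (XY _ qT).
    apply: filterS => w XYw q' q'n _.
    by rewrite (_ : q' = q)//; apply: (pcan_inj (@choice.pickleK rat)); rewrite qn.
  by apply: aeW => w q qn qT; exfalso; apply: nq; exists q.
apply: filterS => w Qw; apply: eq_continuous_ratr => // q.
exact: (Qw (choice.pickle q)).
Qed.

(** * The Kolmogorov-Chentsov estimate and the grid estimate for processes *)

Lemma holder_norm_cst (R : realType) (V : lmodType R) (N : V -> \bar R)
    (T r : R) (x : V) : 0 <= T -> N 0 = 0%E -> (0 <= N x)%E ->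
  holder_norm N T r (fun=> x) = N x.
Proof.
move=> T0 N0 Nx; rewrite /holder_norm [X in (_ + X)%E](_ : _ = 0%E).
  rewrite adde0; apply/eqP; rewrite eq_le; apply/andP; split.
    by apply: nnsup_le => // _ [t _ <-].
  by apply: le_nnsup; exists 0 => //; rewrite /= in_itv/= lexx.
apply/eqP; rewrite eq_le; apply/andP; split; last exact: nnsup_ge0.
by apply: nnsup_le => // _ [q _ <-]; rewrite subrr N0 mul0e.
Qed.

Section kolmogorov_chentsov.
Context {R : realType} {d : measure_display} {Omega : measurableType d}
  (P : probability Omega R).

Lemma Lnorm_probability1 (p : R) : Lnorm P p%:E (cst 1%E) = 1%E.
Proof.
rewrite Lnorm_cst1 -[RHS](poweR1r p^-1); congr (_ `^ _)%E.
exact: probability_setT.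
Qed.

(* The constant process 1 has norm 1 on both sides of the Kolmogorov-Chentsov
   estimate, so that Xi >= 1. Positivity is what makes (ii) hold when the
   right-hand norm is infinite. *)
Lemma kolmogorov_chentsov_constant_gt0 (Xi : R -> R -> R -> R -> R)
    (T p beta alpha : R) : kolmogorov_chentsov_constant Xi ->
  0 <= T -> 1 < p -> p^-1 < beta -> beta <= 1 -> 0 <= alpha ->
  alpha < beta - p^-1 -> 0 < Xi T p alpha beta.
Proof.
move=> hXi T0 p1 pb b1 a0 ab.
have p0 : 0 < p by rewrite (lt_trans _ p1).
pose X (t : R) (w : Omega) : R^o := 1.
have XN : process_holder_norm P p T beta X = 1%E.
  rewrite /process_holder_norm holder_norm_cst//.
  - rewrite /LpE /enorm normr1.
    exact: Lnorm_probability1.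
  - rewrite /LpE /enorm -[RHS](@Lnorm0 _ _ _ P p%:E); last by rewrite eqe gt_eqF.
    by apply: eq_Lnorm => w; rewrite /= normr0.
  - exact: LpE_ge0.
have mX : strongly_measurable_process T X.
  by move=> t _; exact: strongly_measurable_cst.
have Xoo : (process_holder_norm P p T beta X < +oo)%E by rewrite XN ltry.
have [Y [mY cY XY]] := hXi T p beta T0 p1 pb b1 _ _ _ P X mX Xoo.
move=> /(_ alpha a0 ab)[+ _]; rewrite XN mule1 => YXi.
rewrite -lte_fin (lt_le_trans _ YXi)// (@lt_le_trans _ _ (Lnorm P p%:E (cst 1%E)))//.
  by rewrite Lnorm_probability1.
(* Time 0 suffices: the path norm of [Y] dominates [|Y 0 w|], which is 1 almost surely. *)
have T0' : 0 \in `[0, T] by rewrite in_itv/= lexx.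
apply: ae_le_Lnorm; first exact: ltW.
have := ae_eq_strongly_measurable (mX _ T0') (mY _ T0') (XY _ T0').
apply: filterS => w Yw; rewrite [leLHS]gee0_abs ?lee01// gee0_abs ?holder_norm_ge0//.
rewrite (@le_trans _ _ (enorm (Y 0 w)))//; first by rewrite -Yw /enorm normr1.
rewrite -[leLHS]adde0 leeD ?holder_seminorm_ge0//.
by apply: le_nnsup; exists 0.
Qed.

(** The constant controls some continuous modification; almost surely its paths coincide with those
    of [Z] on [0, T], and so do the path norms. *)
Lemma kolmogorov_chentsov_continuous (Xi : R -> R -> R -> R -> R)
    (T p beta alpha : R) (E : completeNormedModType R) (Z : R -> Omega -> E) :
  kolmogorov_chentsov_constant Xi ->
  0 < T -> 1 < p -> p^-1 < beta -> beta <= 1 -> 0 <= alpha ->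
  alpha < beta - p^-1 ->
  strongly_measurable_process T Z -> continuous_paths T Z ->
  (Lnorm P p%:E (path_holder_norm T alpha Z)
     <= (Xi T p alpha beta)%:E * process_holder_norm P p T beta Z)%E.
Proof.
move=> hXi T0 p1 pb b1 a0 ab mZ cZ.
have Xi0 := kolmogorov_chentsov_constant_gt0 hXi (ltW T0) p1 pb b1 a0 ab.
have [->|] := eqVneq (process_holder_norm P p T beta Z) +oo%E.
  by rewrite gt0_muley ?lte_fin// leey.
rewrite -ltey => Zoo.
have [Y [mY cY ZY /(_ alpha a0 ab)[YXi _]]] :=
  hXi T p beta (ltW T0) p1 pb b1 _ _ _ P Z mZ Zoo.
apply: le_trans YXi; apply: ae_le_Lnorm; first by rewrite ltW// (lt_trans _ p1).
apply: filterS (ae_eq_continuous_paths T0 mZ mY cZ cY ZY) => w ZYw.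
by rewrite /path_holder_norm (eq_holder_norm _ _ ZYw).
Qed.

Lemma process_holder_norm_le_grid (T p beta gamma : R) (theta : {fset R})
    (E : normedModType R) (X Y : R -> Omega -> E) :
  0 < T -> is_partition T theta -> 1 <= p -> 0 <= beta -> beta <= gamma ->
  strongly_measurable_process T X -> strongly_measurable_process T Y ->
  (process_holder_norm P p T beta (fun t w => X t w - Y t w)%R
     <= (2 * dmax theta `^ (- beta) + 1)%:E *
        (nnsup [set LpE P p (fun w => X t w - Y t w)%R | t in [set` theta]] +
         (dmax theta `^ gamma)%:E *
         (process_holder_seminorm P p T gamma X +
          process_holder_seminorm P p T gamma Y)))%E.
Proof.
move=> T0 hth p1 b0 bg mX mY.
have mZ t : t \in `[0, T] -> strongly_measurable (fun w => X t w - Y t w).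
  by move=> tT; apply: strongly_measurableB; [exact: mX|exact: mY].
apply: (@holder_norm_le_grid _ _ (LpE P p : (Omega -> E) -> \bar R) T [set` theta]
  (dmax theta) beta gamma (fun t w => X t w - Y t w)) => //.
- by move=> Z; exact: LpE_ge0.
- exact: dmax_gt0 hth.
- by case: hth => + _ _.
- move=> t /(partition_dist T0 hth)[s sth st]; exists s => //.
- move=> s t sT tT; apply: LpE_le_add => //; first exact: mZ.
    by apply: strongly_measurableB; exact: mZ.
  by move=> w; rewrite -{1}(subrKC (X s w - Y s w) (X t w - Y t w)) ler_normD.
- move=> s t sT tT; apply: LpE_le_add => //; [exact: mZ|exact: mZ|].
  by move=> w; exact: ler_normB.
- by rewrite adde_ge0// holder_seminorm_ge0.
move=> s t sT tT st.
(* An increment of the difference is the difference of the increments of [X] and [Y], each bounded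
   by its own seminorm. *)
rewrite ge0_muleDl ?holder_seminorm_ge0//.
apply: le_trans (leeD (le_holder_seminorm _ _ _ sT tT st) (le_holder_seminorm _ _ _ sT tT st)).
apply: LpE_le_add => //.
- by apply: strongly_measurableB; exact: mX.
- by apply: strongly_measurableB; exact: mY.
move=> w; change (`|X t w - Y t w - (X s w - Y s w)|
  <= `|X t w - X s w| + `|Y t w - Y s w|).
by rewrite opprD addrACA -opprD ler_normB.
Qed.

End kolmogorov_chentsov.
Theorem corollary2p8 (R : realType) (Xi : R -> R -> R -> R -> R)
    (hXi : kolmogorov_chentsov_constant Xi)
    (T : R) (hT : 0 < T) (theta : {fset R}) (htheta : is_partition T theta)
    (d : measure_display) (Omega : measurableType d) (P : probability Omega R)
    (E : completeNormedModType R) :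
  (forall p beta gamma : R,
     1 <= p -> 0 <= beta -> beta <= 1 -> beta <= gamma -> gamma <= 1 ->
   forall X Y : R -> Omega -> E,
     strongly_measurable_process T X -> strongly_measurable_process T Y ->
     (process_holder_norm P p T beta (fun t w => X t w - Y t w)%R
      <= (2 * dmax theta `^ (- beta) + 1)%:E *
         (nnsup [set LpE P p (fun w => X t w - Y t w)%R | t in [set` theta]] +
          (dmax theta `^ gamma)%:E *
          (process_holder_seminorm P p T gamma X +
           process_holder_seminorm P p T gamma Y)))%E)
  /\
  (forall p beta alpha gamma : R,
     1 < p -> p^-1 < beta -> beta <= 1 ->
     0 <= alpha -> alpha < beta - p^-1 -> beta <= gamma -> gamma <= 1 ->
   forall X Y : R -> Omega -> E,
     strongly_measurable_process T X -> strongly_measurable_process T Y ->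
     continuous_paths T X -> continuous_paths T Y ->
     (Lnorm P p%:E (path_holder_norm T alpha (fun t w => X t w - Y t w)%R)
      <= (Xi T p alpha beta)%:E *
         process_holder_norm P p T beta (fun t w => X t w - Y t w)%R)%E
     /\
     ((Xi T p alpha beta)%:E *
      process_holder_norm P p T beta (fun t w => X t w - Y t w)%R
      <= (Xi T p alpha beta)%:E * (2 * dmax theta `^ (- beta) + 1)%:E *
         (nnsup [set LpE P p (fun w => X t w - Y t w)%R | t in [set` theta]] +
          (dmax theta `^ gamma)%:E *
          (process_holder_seminorm P p T gamma X +
           process_holder_seminorm P p T gamma Y)))%E).
Proof.
split=> [p beta gamma p1 b0 _ bg _ X Y mX mY|].
  exact: process_holder_norm_le_grid.
move=> p beta alpha gamma p1 pb b1 a0 ab bg _ X Y mX mY cX cY; split.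
  apply: kolmogorov_chentsov_continuous => // [t tT|w].
    by apply: strongly_measurableB; [exact: mX|exact: mY].
  by move=> t; apply: cvgB; [exact: cX|exact: cY].
have Xi0 := kolmogorov_chentsov_constant_gt0 P hXi (ltW hT) p1 pb b1 a0 ab.
have b0 : 0 <= beta.
  by rewrite ltW// (lt_trans _ pb)// invr_gt0 (lt_trans _ p1).
(* The second inequality is (i) multiplied by the positive constant. *)
rewrite -muleA lee_wpmul2l ?lee_fin ?(ltW Xi0)//.
by apply: process_holder_norm_le_grid => //; exact: ltW.
Qed.
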